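(* Let $d\ge 2$ be an integer. For every positive integer $N$, $$\rho_d(N)\le \sum_{k=1}^{d-1}\pi\left(\frac{N}{k}\right)+d\,D\left(\mathbb{Z}_d^{\pi(\sqrt{N})}\right),$$ where $\pi(x)$ denotes the number of primes not exceeding $x$.
   Context: For positive integers $d$ and $N$, $\rho_d(N)$ denotes the maximum size of a set $A\subseteq\{1,2,\dots,N\}$ such that there are no $\ell\ge 1$, pairwise distinct $a_1,\dots,a_\ell\in A$ and integer $x$ with $a_1a_2\cdots a_\ell=x^d$. For a finite abelian group $G$, the Davenport constant $D(G)$ is the smallest positive integer $\ell$ such that every sequence of $\ell$ elements of $G$ (repetitions allowed) contains a non-empty subsequence whose sum is $0$. $\mathbb{Z}_d^m$ denotes the direct sum of $m$ copies of the cyclic group $\mathbb{Z}/d\mathbb{Z}$. *)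

(* Defs.v *)
From HB Require Import structures.
From mathcomp Require Import all_boot all_order all_algebra.
From mathcomp Require Import boolp reals.
Set Implicit Arguments.
Unset Strict Implicit.
Unset Printing Implicit Defensive.
Import Order.TTheory GRing.Theory Num.Theory.
Local Open Scope ring_scope.

(* The bound on p only serves finiteness: p%:R <= x implies p <= truncn x. *)
Definition primepi (R : realType) (x : R) : nat :=
  #|[set p : 'I_(Num.truncn x).+1 | prime p && ((p : nat)%:R <= x)]|.

(* Pairwise distinct a_1, ..., a_l in A with l >= 1 are given by a nonempty
   B \subset A.  Here A is a subset of {0, ..., N}; rho excludes 0. *)
Definition has_power_product (d N : nat) (A : {set 'I_N.+1}) : Prop :=
  exists (B : {set 'I_N.+1}) (x : int),
    [/\ B \subset A, B != set0 & ((\prod_(b in B) (b : nat))%N)%:Z = x ^+ d].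

Definition rho (d N : nat) : nat :=
  (\max_(A : {set 'I_N.+1} |
         (ord0 \notin A) && `[< ~ has_power_product d A >]) #|A|)%N.

Definition zero_sum_length (G : finZmodType) (l : nat) : Prop :=
  forall s : l.-tuple G,
    exists t : seq G, [/\ subseq t s, t <> [::] & \sum_(x <- t) x = 0].

(* Among the #|G|.+1 sums of prefixes of s, two coincide. *)
Lemma zero_sum_length_card (G : finZmodType) : zero_sum_length G #|G|.
Proof.
move=> s; pose f (i : 'I_#|G|.+1) : G := \sum_(x <- take i s) x.
have /injectivePn [i [j neq_ij eq_f]] : ~~ injectiveb f.
  apply/negP => /injectiveP /leq_card; rewrite card_ord ltnn //.
wlog lt_ij : i j neq_ij eq_f / (i < j)%N.
  move=> H; case: (ltngtP i j) => [|lt_ji|/val_inj eq_ij]; first exact: H.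
  - by apply: (H j i) => //; rewrite eq_sym.
  - by rewrite eq_ij eqxx in neq_ij.
have tk : take j s = take i s ++ drop i (take j s).
  by rewrite -{1}(cat_take_drop i (take j s)) take_takel // ltnW.
exists (drop i (take j s)); split.
- exact: subseq_trans (drop_subseq _ _) (take_subseq _ _).
- move/(congr1 size); rewrite size_drop size_take size_tuple /=.
  have := ltn_ord j; rewrite ltnS leq_eqVlt => /orP[/eqP->|->].
    rewrite ltnn => /eqP; rewrite subn_eq0 leqNgt.
    by rewrite (leq_trans lt_ij) // -ltnS.
  by move=> /eqP; rewrite subn_eq0 leqNgt lt_ij.
- by apply: (@addrI _ (f i)); rewrite addr0 {2}eq_f /f [in RHS]tk big_cat.
Qed.

Lemma davenport_ex (G : finZmodType) :
  exists l, (0 < l)%N && `[< zero_sum_length G l >].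
Proof.
exists #|G|; apply/andP; split; first by apply/card_gt0P; exists 0.
by apply/asboolP; exact: zero_sum_length_card.
Qed.

Definition davenport (G : finZmodType) : nat := ex_minn (davenport_ex G).

(* Main.v *)
(* Call a prime p large if p ^ 2 > N; every a <= N has at most one large prime
   divisor, to the first power.  Take a maximal disjoint family of blocks in A:
   nonempty sets of at most d elements in whose product every large prime has
   an exponent divisible by d.  The exponents of these products at the small
   primes form a sequence in Z_d^pi(sqrt N), and a zero-sum subsequence would
   yield a d-th power, so there are fewer than D blocks.  By maximality each of
   the remaining elements has a large prime divisor p, and for a given p there
   are at most min(d - 1, N / p) of them: d multiples of p would form a block.
   Finally min(d - 1, N / p) counts the k in [1, d - 1] with p <= N / k. *)
Require Import Defs.
From mathcomp Require Import all_boot all_order all_algebra.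
From mathcomp Require Import boolp reals.
From mathcomp Require Import zify.
Set Implicit Arguments.
Unset Strict Implicit.
Unset Printing Implicit Defensive.
Import Order.TTheory GRing.Theory Num.Theory.
Local Open Scope ring_scope.

(** The Davenport property concerns sequences of exactly [l] terms, so only the first [l] elements
    of [P] are used. They are pairwise distinct, which turns the zero-sum subsequence into a
    subset. *)
Lemma zero_sum_subset (G : finZmodType) (I : finType) (v : I -> G)
    (P : {set I}) : (davenport G <= #|P|)%N ->
  exists Q : {set I}, [/\ Q \subset P, Q != set0 & \sum_(i in Q) v i = 0].
Proof.
rewrite /davenport; case: ex_minnP => l /andP[_ /asboolP zsl] _ leP.
have szs : size (map v (take l (enum P))) == l.
  by rewrite size_map size_takel // -cardE.
have [t [/subseqP[m _ ->]]] := zsl (Tuple szs).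
rewrite -map_mask /= => nz s0.
have sub : subseq (mask m (take l (enum P))) (enum P).
  exact: subseq_trans (mask_subseq _ _) (take_subseq _ _).
have uq := subseq_uniq sub (enum_uniq _).
exists [set i in mask m (take l (enum P))]; split.
- by apply/subsetP => i; rewrite inE => /(mem_subseq sub); rewrite mem_enum.
- apply/negP => /eqP/setP Q0; apply: nz.
  case: (mask _ _) Q0 => // i s /(_ i).
  by rewrite !inE eqxx.
- rewrite -[RHS]s0 big_map big_uniq //=.
  by apply: eq_bigl => i; rewrite inE.
Qed.

Lemma exists_subset_card (I : finType) (P : {set I}) (n : nat) :
  (n <= #|P|)%N -> exists2 Q : {set I}, Q \subset P & #|Q| = n.
Proof.
move=> leP; exists [set i in take n (enum P)].
  by apply/subsetP => i; rewrite inE => /mem_take; rewrite mem_enum.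
rewrite cardsE (card_uniqP _) ?take_uniq ?enum_uniq //.
by rewrite size_takel // -cardE.
Qed.

Lemma logn_prod (I : finType) (B : {set I}) (F : I -> nat) (p : nat) :
  (forall i, i \in B -> 0 < F i)%N ->
  logn p (\prod_(i in B) F i) = (\sum_(i in B) logn p (F i))%N.
Proof.
move=> F0.
suff [] : logn p (\prod_(i in B) F i) = (\sum_(i in B) logn p (F i))%N
  /\ (0 < \prod_(i in B) F i)%N by [].
apply: (big_ind2 (fun a b => logn p a = b /\ (0 < a)%N)).
- by rewrite logn1.
- by move=> a b c e [<- a0] [<- c0]; rewrite lognM // muln_gt0 a0.
- by move=> i /F0.
Qed.

Lemma perfect_power (d n : nat) : (0 < n)%N ->
  (forall p, prime p -> d %| logn p n)%N -> exists m, n = (m ^ d)%N.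
Proof.
move=> n0 dv; exists (\prod_(p <- primes n) p ^ (logn p n %/ d))%N.
rewrite {1}(prod_prime_decomp n0) prime_decompE big_map /=.
rewrite (@big_morph _ _ (expn^~ d) 1%N muln 1%N muln
  (fun x y => expnMn x y d) (exp1n d)).
rewrite big_seq [RHS]big_seq; apply: eq_bigr => p.
by rewrite mem_primes => /andP[/dv dvp _]; rewrite -expnM divnK.
Qed.

Lemma Zp_natr_eq0 (d n : nat) : (1 < d)%N -> (n%:R == 0 :> 'Z_d) = (d %| n)%N.
Proof.
by move=> d1; rewrite -(inj_eq val_inj) /= val_Zp_nat.
Qed.

(** Replaces the range depending on [x] by a common one, so that prime counts at different points
    can be added prime by prime. *)
Lemma primepiE (R : realType) (x : R) (M : nat) :
  0 <= x -> x < M.+1%:R ->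
  primepi x = (\sum_(p < M.+1) (prime p && ((p : nat)%:R <= x)%R))%N.
Proof.
move=> x0 xM; rewrite /primepi -sum1dep_card big_mkcond /=.
rewrite (big_ord_widen M.+1 (fun p => if prime p && (p%:R <= x)%R then 1%N else 0%N));
  last by rewrite ltnS -ltnS truncn_lt_nat.
rewrite big_mkcond; apply: eq_bigr => p _ /=.
rewrite ltnS truncn_ge_nat //.
by case: (prime p); case: (_ <= _).
Qed.

Lemma primepi_div (R : realType) (N k : nat) : (0 < k)%N ->
  primepi (N%:R / k%:R : R) = (\sum_(p < N.+1) (prime p && (p * k <= N)))%N.
Proof.
move=> k0; have k0R : 0 < k%:R :> R by rewrite ltr0n.
rewrite (@primepiE _ _ N) ?divr_ge0 ?ler0n //; last first.
  by rewrite ltr_pdivrMr // -natrM ltr_nat; nia.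
by apply: eq_bigr => p _; rewrite ler_pdivlMr // -natrM ler_nat.
Qed.

Definition small_primes (N : nat) : {set 'I_N.+1} :=
  [set p : 'I_N.+1 | prime p && (p * p <= N)%N].

Lemma primepi_sqrt (R : realType) (N : nat) :
  primepi (Num.sqrt N%:R : R) = #|small_primes N|.
Proof.
have le_sqrt (p : nat) : (p%:R <= Num.sqrt N%:R :> R) = (p * p <= N)%N.
  rewrite -(ler_pXn2r (n := 2)) ?nnegrE ?sqrtr_ge0 ?ler0n //.
  by rewrite sqr_sqrtr ?ler0n // -natrX ler_nat.
rewrite (@primepiE _ _ N) ?sqrtr_ge0 //; last first.
  by rewrite ltNge le_sqrt; nia.
rewrite -sum1dep_card [RHS]big_mkcond; apply: eq_bigr => p _ /=.
by rewrite le_sqrt; case: (_ && _).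
Qed.

Lemma sum_leq_minn (m n : nat) : (\sum_(1 <= k < n.+1) (k <= m) = minn n m)%N.
Proof.
elim: n => [|n IH]; first by rewrite big_geq // min0n.
by rewrite big_nat_recr //= IH; lia.
Qed.

(** Division by [p] maps [C] injectively into 1, ..., N / p. *)
Lemma card_multiples (N p : nat) (C : {set 'I_N.+1}) : (0 < p)%N ->
  (forall a : 'I_N.+1, a \in C -> 0 < a /\ p %| a)%N -> (#|C| <= N %/ p)%N.
Proof.
move=> p0 dvC.
rewrite -(size_iota 1 (N %/ p)) cardE -(size_map (fun a : 'I_N.+1 => a %/ p)%N).
apply: uniq_leq_size.
  rewrite map_inj_in_uniq ?enum_uniq // => a b; rewrite !mem_enum.
  move=> /dvC[_ pa] /dvC[_ pb] eq_ab; apply: val_inj.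
  by rewrite /= -(divnK pa) eq_ab divnK.
move=> _ /mapP[a + ->]; rewrite mem_enum mem_iota => /dvC[a0 pa].
by rewrite divn_gt0 // dvdn_leq //= add1n ltnS leq_div2r // -ltnS.
Qed.

(** Only small primes get a coordinate, since [block] controls the large ones. ['Z_d] is the ring of
    integers modulo [d] only when [1 < d]. *)
Definition exponents (d N n : nat) : 'rV['Z_d]_#|small_primes N| :=
  \row_i (logn (@enum_val _ (mem (small_primes N)) i) n)%:R.

Lemma perfect_power_exponents (d N n : nat) : (1 < d)%N -> (0 < n)%N ->
  (forall p, prime p -> N < p * p -> d %| logn p n)%N ->
  exponents d N n = 0 -> exists m, n = (m ^ d)%N.
Proof.
move=> d1 n0 large exp0; apply: perfect_power => // p prp.
have [lt_N|le_N] := ltnP N (p * p); first exact: large.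
have pN : (p < N.+1)%N by have := prime_gt1 prp; nia.
have pS : Ordinal pN \in small_primes N by rewrite inE prp.
move/rowP: exp0 => /(_ (enum_rank_in pS (Ordinal pN))).
by rewrite !mxE enum_rankK_in // => /eqP; rewrite Zp_natr_eq0.
Qed.

(* Every a <= N has at most one prime divisor p with N < p ^ 2. *)
Lemma logn_large_primes (N p q a : nat) :
  prime p -> prime q -> (N < p * p)%N -> (N < q * q)%N ->
  (0 < a <= N)%N -> (p %| a)%N -> logn q a = (q == p).
Proof.
move=> prp prq lt_p lt_q /andP[a0 aN] pa.
move: (a %/ p)%N (divnK pa) => b pf.
have b0 : (0 < b)%N by case: b pf a0 => // <-.
have p0 := prime_gt0 prp.
rewrite -pf lognM // (logn_prime _ prp) [logn q b]lognE prq b0 /=.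
(* If [q] also divided the cofactor [b], then p q <= a <= N, whereas p ^ 2 > N and q ^ 2 > N force p
   q > N. *)
case: ifP => // qb; have := dvdn_leq b0 qb; nia.
Qed.

(* Up to a d-th power, the product of a block is determined by its exponents
   at the primes p with p ^ 2 <= N. *)
Definition block (d N : nat) (B : {set 'I_N.+1}) : Prop :=
  [/\ B != set0, (#|B| <= d)%N &
   forall p, prime p -> (N < p * p)%N -> (d %| logn p (\prod_(b in B) b))%N].

Lemma card_cover_le (I : finType) (P : {set {set I}}) (d : nat) :
  (forall B, B \in P -> #|B| <= d)%N -> (#|cover P| <= d * #|P|)%N.
Proof.
move=> Pd; apply: leq_trans (leq_card_cover P) _.
by rewrite mulnC -sum_nat_const; exact: leq_sum.
Qed.

(** Disjointness makes the product over [cover Q] the product of the block products, so a zero sum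
    over [Q] yields a [d]-th power of distinct elements of [A]. *)
Lemma card_blocks (d N : nat) (A : {set 'I_N.+1}) (P : {set {set 'I_N.+1}}) :
  (1 < d)%N -> ord0 \notin A -> ~ has_power_product d A ->
  trivIset P -> (forall B, B \in P -> B \subset A /\ block d B) ->
  (#|P| < davenport 'rV['Z_d]_#|small_primes N|)%N.
Proof.
move=> d1 A0 noA tP blP; rewrite ltnNge; apply/negP => leP; apply: noA.
pose v (B : {set 'I_N.+1}) := exponents d N (\prod_(b in B) b).
have [Q [QP Q0 sumQ]] := zero_sum_subset v leP.
have A_gt0 (a : 'I_N.+1) : a \in A -> (0 < a)%N.
  move=> aA; rewrite lt0n; apply: contraNneq A0 => a0.
  by rewrite (_ : ord0 = a) //; apply: val_inj.
have B_gt0 B : B \in Q -> (0 < \prod_(b in B) b)%N.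
  move=> /(subsetP QP)/blP[/subsetP BA _].
  by rewrite prodn_cond_gt0 // => b /BA/A_gt0.
have covA : cover Q \subset A.
  by apply/bigcupsP => B /(subsetP QP)/blP[].
have prodE : (\prod_(b in cover Q) b = \prod_(B in Q) \prod_(b in B) b)%N.
  exact: (big_trivIset _ (trivIsetS QP tP)).
have [|||m mE] := @perfect_power_exponents d N (\prod_(b in cover Q) b) d1.
- by rewrite prodn_cond_gt0 // => b /(subsetP covA)/A_gt0.
- move=> p prp pN; rewrite prodE logn_prod //.
  by apply: dvdn_sum => B /(subsetP QP)/blP[_ [_ _]]; exact.
- rewrite -sumQ; apply/rowP => i.
  rewrite summxE mxE prodE logn_prod // natr_sum.
  by apply: eq_bigr => B _; rewrite mxE.
exists (cover Q), m%:Z; split=> //.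
- have [B BQ] := set0Pn _ Q0.
  have [_ [/set0Pn[b bB] _ _]] := blP _ (subsetP QP _ BQ).
  by apply/set0Pn; exists b; apply/bigcupP; exists B.
- by rewrite mE -!natz natrX.
Qed.

Lemma block_free_card (d N : nat) (C : {set 'I_N.+1}) :
  (1 < d)%N -> ord0 \notin C ->
  (forall B : {set 'I_N.+1}, B \subset C -> ~ block d B) ->
  (#|C| <= \sum_(1 <= k < d) \sum_(p < N.+1) (prime p && (p * k <= N)))%N.
Proof.
move=> d1 C0 noB.
have C_gt0 (a : 'I_N.+1) : a \in C -> (0 < a)%N.
  move=> aC; rewrite lt0n; apply: contraNneq C0 => a0.
  by rewrite (_ : ord0 = a) //; apply: val_inj.
pose large (p : nat) := prime p && (N < p * p)%N.
pose mult (p : nat) := [set a : 'I_N.+1 in C | p %| a]%N.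
have cover_large : C \subset \bigcup_(p < N.+1 | large p) mult p.
  apply/subsetP => a aC; apply/negPn/negP => no_p.
  (* An element without large prime divisor is a block by itself. *)
  apply: (noB [set a]); first by rewrite sub1set.
  split; rewrite ?cards1 ?(ltnW d1) //.
    by apply/set0Pn; exists a; rewrite inE.
  move=> p prp pN; rewrite big_set1 lognE prp C_gt0 //=.
  case: ifP => // pa; case/negP: no_p.
  have ltp : (p < N.+1)%N.
    by apply: leq_ltn_trans (ltn_ord a); apply: dvdn_leq => //; exact: C_gt0.
  by apply/bigcupP; exists (Ordinal ltp); rewrite ?inE /= ?aC // /large prp.
have mult_lt_d p : large p -> (#|mult p| < d)%N.
  move=> /andP[prp pN]; rewrite ltnNge; apply/negP => /exists_subset_card[B].
  move=> /subsetP sBm cardB; have BC : {subset B <= C}.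
    by move=> b /sBm; rewrite inE => /andP[].
  apply: (noB B); first exact/subsetP.
  split; first by rewrite -card_gt0 cardB ltnW.
    by rewrite cardB.
  move=> q prq qN; rewrite logn_prod; last by move=> b /BC/C_gt0.
  (* Each factor has exponent 1 at [p] and 0 at every other large prime, so the [d] factors total
     [d] or 0. *)
  rewrite (eq_bigr (fun=> (q == p) : nat)); last first.
    move=> b /[dup] /BC/C_gt0 b0 /sBm; rewrite inE => /andP[_ pb].
    by apply: (logn_large_primes prp prq pN qN _ pb); rewrite b0 -ltnS /=.
  by rewrite sum_nat_const cardB dvdn_mulr.
apply: leq_trans (subset_leq_card cover_large) _.
have card_bigcup : (#|\bigcup_(p < N.+1 | large p) mult p| <=
    \sum_(p < N.+1 | large p) #|mult p|)%N.
  elim/big_rec2: _ => [|p n B _ le_n]; first by rewrite cards0.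
  by apply: leq_trans (leq_card_setU _ _) _; rewrite leq_add2l.
apply: leq_trans card_bigcup _.
(* With the sum over primes outside, each large [p] contributes the number of k < d with k <= N / p,
   that is min(d - 1, N / p); the other primes only enlarge the right-hand side. *)
rewrite exchange_big /= big_mkcond leq_sum // => p _.
case: ifP => // lp; have /andP[prp _] := lp; have p0 := prime_gt0 prp.
under eq_bigr => k _ do rewrite prp /= mulnC -leq_divRL //.
case: d d1 mult_lt_d {noB} => // d d1 mult_lt_d.
rewrite sum_leq_minn leq_min -ltnS mult_lt_d //=.
apply: card_multiples => // a; rewrite inE => /andP[/C_gt0].
by split.
Qed.

Unset Implicit Arguments.

Theorem theorem5 (R : realType) (d N : nat) (hd : (2 <= d)%N) (hN : (0 < N)%N) :
  (rho d N <= \sum_(1 <= k < d) primepi (N%:R / k%:R : R)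
              + d * davenport 'rV['Z_d]_(primepi (Num.sqrt N%:R : R)))%N.
Proof.
rewrite primepi_sqrt big_nat.
under eq_bigr => k /andP[k0 _] do rewrite primepi_div //.
rewrite -big_nat; apply/bigmax_leqP => A /andP[A0 /asboolP noA].
pose packing (P : {set {set 'I_N.+1}}) := trivIset P &&
  [forall B in P, (B \subset A) && `[< block d B >]].
have [|P /maxsetP[/andP[tP /forall_inP blP] maxP]] := @ex_maxset _ packing.
  exists set0; apply/andP; split; first by apply/trivIsetP => B; rewrite inE.
  by apply/forall_inP => B; rewrite inE.
have blP' B : B \in P -> B \subset A /\ block d B.
  by move=> /blP/andP[BA /asboolP].
rewrite -(cardsID (cover P) A) addnC leq_add //; last first.
  apply: leq_trans (subset_leq_card (subsetIr _ _)) _.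
  apply: leq_trans (@card_cover_le _ P d _) _.
    by move=> B /blP'[_ []].
  by rewrite leq_mul2l (ltnW (card_blocks hd A0 noA tP blP')) orbT.
(* A block [B] inside [A] but outside [cover P] could be added to [P], against maximality. *)
apply: block_free_card => // [|B sB blB].
  by apply: contraNN A0; rewrite inE => /andP[].
have dis : [disjoint B & cover P].
  by move: sB; rewrite subsetD => /andP[].
have BA : B \subset A by move: sB; rewrite subsetD => /andP[].
have [B0 _ _] := blB.
(* A member of [P] lies inside [cover P], so being disjoint from it would make [B] empty. *)
have nBP : B \notin P.
  apply: contra B0 => BP; move: dis; rewrite -setI_eq0 => /eqP <-.
  by rewrite eqEsubset subsetIl subsetI subxx /= bigcup_sup.
have P0 : set0 \notin P by apply/negP => /blP'[_ []]; rewrite eqxx.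
have [|tBP _] := @trivIsetU1 _ B P _ tP P0.
  by move=> B' B'P; apply: disjointWr dis; exact: bigcup_sup.
case/negP: nBP; rewrite -(maxP (B |: P)) ?setU11 ?subsetUr //.
rewrite /packing tBP; apply/forall_inP => B'; rewrite !inE.
by case/predU1P => [->|/blP //]; rewrite BA; apply/asboolP.
Qed.
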